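(* Let $m,n,k$ be positive integers, let $\mathbf{F},\mathbf{Y}$ be complex $m\times k$ matrices and let $\mathbf{X},\mathbf{H}$ be complex $n\times k$ matrices. If $\mathbf{F}\mathbf{Y}^*$ and $\mathbf{X}\mathbf{H}^*$ are idempotent matrices of rank $k$, then $$\mathbf{Y}^*\mathbf{F}=\mathbf{H}^*\mathbf{X}=\mathbf{I}_k .$$ Conversely, if $\mathbf{Y}^*\mathbf{F}=\mathbf{H}^*\mathbf{X}=\mathbf{I}_k$, then $\mathbf{F}\mathbf{Y}^*$ and $\mathbf{X}\mathbf{H}^*$ are idempotent matrices of rank $k$.
   Context: $\mathbf{W}^*$ denotes the conjugate transpose of a matrix $\mathbf{W}$, and $\mathbf{I}_k$ is the $k\times k$ identity matrix. A square matrix $\mathbf{P}$ is idempotent if $\mathbf{P}^2=\mathbf{P}$. *)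

(* Defs.v *)
From HB Require Import structures.
From mathcomp Require Import all_boot all_order all_algebra.
From mathcomp Require Import all_reals.
From mathcomp Require Import complex.
Set Implicit Arguments.
Unset Strict Implicit.
Unset Printing Implicit Defensive.
Local Open Scope ring_scope.

Definition idempotent_mx (K : pzRingType) (n : nat) (P : 'M[K]_n) : Prop :=
  P *m P = P.

(* Main.v *)
Require Import Defs.
From HB Require Import structures.
From mathcomp Require Import all_boot all_order all_algebra.
From mathcomp Require Import all_reals.
From mathcomp Require Import complex.
Set Implicit Arguments.
Unset Strict Implicit.
Unset Printing Implicit Defensive.
Import Order.TTheory GRing.Theory Num.Theory.
Local Open Scope ring_scope.
Local Open Scope complex_scope.
Local Open Scope sesquilinear_scope.

(** The claims about [F, Y] and about [X, H] are the same claim, about the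
    product [A *m B] of an [m x k] and a [k x m] matrix over any field: that
    claim is [idempotent_rank_mulmx], applied to [B] the conjugate transpose of
    [Y] or [H].

    The rank of [A B] cannot exceed the inner dimension [k], and if it equals
    [k] both factors have full rank ([mulmx_rank_inner]), so that [A] cancels on the left and [B] on
    the right; cancelling them in [A B A B = A B] leaves [B A = 1].  Conversely,
    [B A = 1] collapses the middle of [A B A B], and it makes the identity of
    size [k] equal to [B (A B) A], which forces the rank of [A B] up to [k]. *)

(** A product has no more rank than either factor, and [k] is the most that
    factors with inner dimension [k] can have. *)
Lemma mulmx_rank_inner (K : fieldType) (m n k : nat)
    (A : 'M[K]_(m, k)) (B : 'M[K]_(k, n)) :
  \rank (A *m B) = k -> row_full A /\ row_free B.
Proof.
move=> rkAB; split.
  by rewrite -col_leq_rank -{1}rkAB mxrankM_maxl.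
by rewrite -row_leq_rank -{1}rkAB mxrankM_maxr.
Qed.

Lemma idempotent_rank_mulmx (K : fieldType) (m k : nat)
    (A : 'M[K]_(m, k)) (B : 'M[K]_(k, m)) :
  idempotent_mx (A *m B) /\ \rank (A *m B) = k <-> B *m A = 1%:M.
Proof.
rewrite /idempotent_mx; split=> [[idAB rkAB] | BA1].
  have [fullA freeB] := mulmx_rank_inner rkAB.
  apply: (row_full_inj fullA); apply: (row_free_inj freeB).
  by rewrite mulmx1 -[RHS]idAB !mulmxA.
split; first by rewrite mulmxA -(mulmxA A B A) BA1 mulmx1.
apply/eqP; rewrite eqn_leq mulmx_max_rank /=.
have def1 : B *m (A *m B) *m A = 1%:M by rewrite mulmxA BA1 mul1mx.
rewrite -{1}(mxrank1 K k) -def1.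
exact: leq_trans (mxrankM_maxl _ _) (mxrankM_maxr _ _).
Qed.

Theorem theorem1 (R : realType) (m n k : nat)
    (m_gt0 : (0 < m)%N) (n_gt0 : (0 < n)%N) (k_gt0 : (0 < k)%N)
    (F Y : 'M[R[i]]_(m, k)) (X H : 'M[R[i]]_(n, k)) :
  ((idempotent_mx (F *m Y^t* ) /\ \rank (F *m Y^t* ) = k) /\
   (idempotent_mx (X *m H^t* ) /\ \rank (X *m H^t* ) = k))
  <->
  (Y^t* *m F = 1%:M /\ H^t* *m X = 1%:M).
Proof.
by rewrite !idempotent_rank_mulmx.
Qed.
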